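(* Let $V=(e_1,e_2,\ldots)$ with $e_i\in\{0,1\}$ be an infinite binary vector containing infinitely many terms equal to $1$. Then $\lim_{j\to+\infty} N_{0,j}(V)=+\infty$ if and only if the sequence $\left(\dfrac{N_{0,j}(V)}{2^{j}}\right)_{j\ge 1}$ does not converge to $0$.
   Context: The Collatz map $T:\mathbb{N}^*\to\mathbb{N}^*$ (where $\mathbb{N}^*$ is the set of positive integers) is $T(N)=N/2$ if $N$ is even and $T(N)=(3N+1)/2$ if $N$ is odd. For an integer $N$ let $\mathbf{i}(N)=0$ if $N$ is even and $\mathbf{i}(N)=1$ if $N$ is odd. For $N\in\mathbb{N}^*$ and $n\ge1$, the parity vector of length $n$ of the Collatz sequence starting at $N$ is $v_n(N)=(\mathbf{i}(N),\mathbf{i}(T(N)),\ldots,\mathbf{i}(T^{n-1}(N)))$. For an infinite binary vector $V=(e_1,e_2,\ldots)$ and $j\ge1$, put $R_j(V)=(e_1,\ldots,e_j)$, and let $N_{0,j}(V)$ be the least positive integer $N$ such that $v_j(N)=R_j(V)$ (it exists and satisfies $1\le N_{0,j}(V)\le 2^j$). *)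

(* Defs.v *)
From HB Require Import structures.
From mathcomp Require Import all_boot zify.

Set Implicit Arguments.
Unset Strict Implicit.
Unset Printing Implicit Defensive.

(* Intended for N > 0, a set stable under [collatz]. *)
Definition collatz (N : nat) : nat :=
  if odd N then (3 * N + 1)./2 else N./2.

(* Parities are booleans: [true] stands for 1 and [false] for 0. *)
Definition parity_vector (n N : nat) : n.-tuple bool :=
  [tuple odd (iter i collatz N) | i < n].

(* An infinite binary vector (e_1, e_2, ...) is a function V : nat -> bool
   with V i = e_{i+1}. *)
Definition truncation (j : nat) (V : nat -> bool) : j.-tuple bool :=
  [tuple V i | i < j].

Lemma collatz_mod_inj k N M : odd N = odd M ->
  collatz N = collatz M %[mod 2 ^ k] -> N = M %[mod 2 ^ k.+1].
Proof.
wlog le_MN : N M / M <= N => [hw|].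
  by case: (leqP M N) => [/hw//|/ltnW/hw h oNM /esym e]; symmetry; apply: h.
move=> oNM /eqP; rewrite /collatz -oNM => e; apply/eqP; move: e.
have eN := odd_double_half N; have eM := odd_double_half M.
have le_h : M./2 <= N./2 by exact: half_leq.
have eNM : N - M = 2 * (N./2 - M./2) by rewrite oNM in eN; lia.
rewrite (eqn_mod_dvd (2 ^ k.+1) le_MN) eNM expnS dvdn_pmul2l//.
have oddE P : odd P -> (3 * P + 1)./2 = 3 * P./2 + 2 by move=> oP; lia.
case: ifP => oN; last by rewrite eqn_mod_dvd.
rewrite !oddE -?oNM// eqn_modDr eqn_mod_dvd; last by rewrite leq_mul2l le_h.
by rewrite -mulnBr Gauss_dvdr // coprimeXl.
Qed.

Lemma parity_vector_mod_inj n N M :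
  parity_vector n N = parity_vector n M -> N = M %[mod 2 ^ n].
Proof.
elim: n N M => [|n IHn] N M eNM; first by rewrite expn0 !modn1.
have nthE i : i < n.+1 -> odd (iter i collatz N) = odd (iter i collatz M).
  move=> lt_in; have := congr1 (fun t => tnth t (Ordinal lt_in)) eNM.
  by rewrite !tnth_mktuple.
apply: collatz_mod_inj; first exact: (nthE 0).
apply: IHn; apply: eq_from_tnth => i; rewrite !tnth_mktuple.
by have := nthE i.+1 (ltn_ord i); rewrite !iterSr.
Qed.

Lemma ex_parity_vector j (V : nat -> bool) :
  exists N, (0 < N) && (parity_vector j N == truncation j V).
Proof.
have inj : injective (fun i : 'I_(2 ^ j) => parity_vector j i.+1).
  move=> a b /parity_vector_mod_inj /eqP.
  rewrite -(addn1 a) -(addn1 b) eqn_modDr.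
  by rewrite !modn_small // => /eqP /val_inj.
have [|f _ fK] := inj_card_bij inj; first by rewrite card_tuple card_bool card_ord.
by exists (f (truncation j V)).+1; rewrite /= fK.
Qed.

(* N_{0,j}(V), characterized by [ex_minnP]; only j >= 1 is meaningful (N0 V 0 = 1). *)
Definition N0 (V : nat -> bool) (j : nat) : nat := ex_minn (ex_parity_vector j V).

(* Main.v *)
Require Import Defs.
From mathcomp Require Import all_boot all_order all_algebra.
From mathcomp Require Import all_classical all_reals all_analysis.

Import Order.TTheory GRing.Theory Num.Theory.
Import numFieldNormedType.Exports.

Local Open Scope classical_set_scope.
Local Open Scope ring_scope.

(** Write N_j for [N0 V j].  The sequence N_j is nondecreasing, because an
    integer realizing the first j+1 parities also realizes the first j, and it
    moves by large steps only: N_(j+1) and N_j share their first j parities,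
    hence are congruent modulo 2^j, so that either N_(j+1) = N_j or
    N_(j+1) > 2^j ([N0S_eq_or_gt]).

    Consequently N_j / 2^j exceeds 1/2 just after each jump.  If N_j / 2^j tends
    to 0 there are thus finitely many jumps, N_j is eventually constant and does
    not tend to infinity.  Conversely, a nondecreasing sequence that does not
    tend to infinity is bounded, and a bounded sequence divided by 2^j tends to
    0. *)

Lemma parity_vector_N0 V j : parity_vector j (N0 V j) = truncation j V.
Proof. by rewrite /N0; case: ex_minnP => m /andP[_ /eqP]. Qed.

Lemma N0_gt0 V j : (0 < N0 V j)%N.
Proof. by rewrite /N0; case: ex_minnP => m /andP[]. Qed.

Lemma N0_min V j N :
  (0 < N)%N -> parity_vector j N = truncation j V -> (N0 V j <= N)%N.
Proof.
move=> N_gt0 eN; rewrite /N0; case: ex_minnP => m _; apply.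
by rewrite N_gt0 eN eqxx.
Qed.

Lemma parity_vector_truncation_le V i j N : (i <= j)%N ->
  parity_vector j N = truncation j V -> parity_vector i N = truncation i V.
Proof.
move=> le_ij eN; apply: eq_from_tnth => k; rewrite !tnth_mktuple.
have := congr1 (fun t => tnth t (widen_ord le_ij k)) eN.
by rewrite !tnth_mktuple.
Qed.

Lemma N0_le V i j : (i <= j)%N -> (N0 V i <= N0 V j)%N.
Proof.
move=> le_ij; apply: N0_min; first exact: N0_gt0.
exact: parity_vector_truncation_le _ _ _ _ le_ij (parity_vector_N0 V j).
Qed.

(** A nonzero difference of two integers that are congruent modulo 2^j is at
    least 2^j. *)
Lemma N0S_eq_or_gt V j : N0 V j.+1 = N0 V j \/ (2 ^ j < N0 V j.+1)%N.
Proof.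
have le_N := N0_le V _ _ (leqnSn j).
have : N0 V j.+1 = N0 V j %[mod 2 ^ j].
  apply: parity_vector_mod_inj; rewrite parity_vector_N0.
  exact: parity_vector_truncation_le _ _ _ _ (leqnSn j) (parity_vector_N0 V j.+1).
move/eqP; rewrite eqn_mod_dvd //.
have [le_N'|lt_N] := leqP (N0 V j.+1) (N0 V j).
  by move=> _; left; apply/eqP; rewrite eqn_leq le_N' le_N.
move=> /dvdn_leq; rewrite subn_gt0 => /(_ lt_N) le_jump; right.
rewrite -(subnK le_N) -[ltnLHS]addn0 -addnS.
by apply: leq_add => //; exact: N0_gt0.
Qed.

Lemma cvg_bounded_div_pow2 (R : realType) (u : nat -> nat) (A : R) :
  (forall j, (u j)%:R <= A) -> ((u j)%:R / 2 ^+ j : R) @[j --> \oo] --> (0 : R).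
Proof.
move=> u_le.
have geo0 : (geometric A (2^-1 : R)) j @[j --> \oo] --> (0 : R).
  by apply: cvg_geometric; rewrite ger0_norm ?invr_ge0 // invf_lt1 // ltr1n.
apply: (squeeze_cvgr _ (cvg_cst (0 : R)) geo0); near=> j.
rewrite divr_ge0 ?exprn_ge0 //= exprVn.
by rewrite ler_wpM2r ?invr_ge0 ?exprn_ge0.
Unshelve. all: by end_near. Qed.

Lemma cvgry_nondecreasing_nat (R : realType) (u : nat -> nat) :
    (forall i j, (i <= j)%N -> (u i <= u j)%N) ->
    (forall A : R, exists j, A <= (u j)%:R) ->
  ((u j)%:R : R) @[j --> \oo] --> +oo.
Proof.
move=> u_le u_unbounded; apply/cvgryPge => A.
have [i le_A] := u_unbounded A.
near=> j; apply: (le_trans le_A); rewrite ler_nat u_le //.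
by near: j; exact: nbhs_infty_ge.
Unshelve. all: by end_near. Qed.

Lemma N0_eventually_constant (R : realType) V :
  ((N0 V j)%:R / 2 ^+ j : R) @[j --> \oo] --> (0 : R) ->
  exists n, forall j, (n <= j)%N -> N0 V j = N0 V n.
Proof.
move=> /cvgr_lt /(_ (2^-1 : R)); rewrite invr_gt0 ltr0n => /(_ isT) [n _ lt_half].
exists n; elim=> [|j IHj]; first by rewrite leqn0 => /eqP ->.
rewrite leq_eqVlt => /predU1P[-> //|]; rewrite ltnS => le_nj.
have [->|jump] := N0S_eq_or_gt V j; first exact: IHj.
(* The ratio at j.+1 is below 1/2, whereas a jump there brings it above. *)
have /= := lt_half j.+1 (leqW le_nj).
rewrite ltr_pdivrMr ?exprn_gt0 // exprS mulKf ?pnatr_eq0 // -natrX ltr_nat.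
by rewrite ltnNge (ltnW jump).
Qed.

Theorem theorem6p1 (R : realType) (V : nat -> bool)
    (V_inf : infinite_set [set i : nat | V i = true]) :
  (((N0 V j)%:R : R) @[j --> \oo] --> +oo) <->
  ~ (((N0 V j)%:R / 2 ^+ j : R) @[j --> \oo] --> (0 : R)).
Proof.
split=> [/cvgryPgt N0_oo /N0_eventually_constant[n N0_cst]|ratio_n0].
  have [m _ /(_ (maxn m n) (leq_maxl _ _)) /=] := N0_oo (N0 V n)%:R.
  by rewrite N0_cst ?leq_maxr // ltxx.
apply: cvgry_nondecreasing_nat => [|A]; first exact: N0_le.
apply: contrapT => /forallNP N0_lt; apply: ratio_n0.
apply: (@cvg_bounded_div_pow2 _ _ A) => j.
by rewrite leNgt; apply/negP => /ltW /N0_lt.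
Qed.
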